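(* Let $m\le n$, $r\in[m]$, $S\subset[m]\times[n]$, $U\in\mathbb{R}^{m\times n}$ and consider a critical point $X=(x_{ij})\in\mathcal{L}_r^S$ of $d_U$. Let $A\times B\subset[m]\times[n]$ with $|A|=|B|\ge m-r+1$ and such that $S\cap(A\times B)=\emptyset$. Then $M_{A,B}(U-X)=0$.
   Context: Notation: $[m]=\{1,\dots,m\}$; $\mathcal{X}_r=\{X\in\mathbb{C}^{m\times n}\mid\mathrm{rank}(X)\le r\}$, $\mathcal{L}^S=\{X=(x_{ij})\in\mathbb{C}^{m\times n}\mid x_{ij}=0\ \forall(i,j)\in S\}$, $\mathcal{L}_r^S=\mathcal{X}_r\cap\mathcal{L}^S$. For $A\subset[m]$, $B\subset[n]$ with $|A|=|B|$, $M_{A,B}(Y)$ denotes the minor of $Y$ with rows in $A$ and columns in $B$. $d_U(X)=\sum_{i,j}(x_{ij}-u_{ij})^2$ on $\mathbb{C}^{m\times n}$. A critical point of $d_U$ on an algebraic variety $\mathcal{X}\subset\mathbb{C}^{m\times n}$ is a smooth point $X\in\mathcal{X}$ such that $U-X$ is orthogonal to the tangent space $T_X\mathcal{X}$ with respect to the complex bilinear form $\langle A,B\rangle_F=\mathrm{trace}(AB^T)$. *)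

(* Defs.v *)
From HB Require Import structures.
From mathcomp Require Import all_boot all_order all_algebra.
From mathcomp Require Import classical_sets reals.
From mathcomp Require Import complex.
From mathcomp Require Import mpoly.

Set Implicit Arguments.
Unset Strict Implicit.
Unset Printing Implicit Defensive.

Import GRing.Theory Num.Theory.

Local Open Scope classical_set_scope.
Local Open Scope ring_scope.

(* Affine algebraic geometry in the space of m x n matrices over a field K.
   The coordinate ring is {mpoly K[m * n]}; the variable of index
   mxvec_index i j stands for the (i, j) entry. *)
Section AffineGeometry.
Variables (K : fieldType) (m n : nat).
Implicit Types (Z W : set 'M[K]_(m, n)) (X V : 'M[K]_(m, n)).

Definition eval_mx (p : {mpoly K[m * n]}) X : K :=
  p.@[fun k => mxvec X 0 k].

Definition vanishing_ideal Z : set {mpoly K[m * n]} :=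
  [set p | forall Y, Z Y -> eval_mx p Y = 0].

Definition zero_locus (I : set {mpoly K[m * n]}) : set 'M[K]_(m, n) :=
  [set Y | forall p, I p -> eval_mx p Y = 0].

Definition zariski_closed Z : Prop := exists I, Z = zero_locus I.

Definition zariski_irreducible Z : Prop :=
  Z !=set0 /\
  forall W1 W2, zariski_closed W1 -> zariski_closed W2 ->
    Z `<=` W1 `|` W2 -> Z `<=` W1 \/ Z `<=` W2.

(* Chains of irreducible closed subsets of Z passing through X correspond to
   chains of prime ideals in the local ring of Z at X. *)
Definition chain_through Z X (d : nat) : Prop :=
  exists W : nat -> set 'M[K]_(m, n),
    (forall i, (i <= d)%N ->
       [/\ zariski_closed (W i), zariski_irreducible (W i),
           W i X & W i `<=` Z]) /\
    (forall i, (i < d)%N -> W i `<` W i.+1).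

(* Krull dimension of the local ring of Z at X, i.e. the largest dimension of
   an irreducible component of Z through X. *)
Definition local_dim Z X (d : nat) : Prop :=
  chain_through Z X d /\ forall e, chain_through Z X e -> (e <= d)%N.

Definition differential (p : {mpoly K[m * n]}) X V : K :=
  \sum_(k < m * n) eval_mx p^`M(k) X * mxvec V 0 k.

(* Zariski tangent space, cut out by the full vanishing ideal of Z. *)
Definition tangent_space Z X : set 'M[K]_(m, n) :=
  [set V | forall p, vanishing_ideal Z p -> differential p X V = 0].

(* Z may be reducible and of mixed dimension, so the dimension of the tangent
   space is compared with the local dimension of Z at X. *)
Definition smooth_point Z X : Prop :=
  Z X /\
  exists2 T : {vspace 'M[K]_(m, n)},
    (forall V, V \in T <-> tangent_space Z X V) & local_dim Z X (\dim T).

(* Critical points on Z of the squared distance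
   d_U(X) = \sum_(i, j) (X i j - U i j) ^+ 2. *)
Definition critical_point (U : 'M[K]_(m, n)) Z X : Prop :=
  smooth_point Z X /\
  forall V, tangent_space Z X V -> \tr ((U - X) *m V^T) = 0.

Definition bounded_rank (r : nat) : set 'M[K]_(m, n) :=
  [set X | (\rank X <= r)%N].

Definition zero_pattern (S : {set 'I_m * 'I_n}) : set 'M[K]_(m, n) :=
  [set X | forall i j, (i, j) \in S -> X i j = 0].

Definition structured_bounded_rank (r : nat) (S : {set 'I_m * 'I_n}) :
    set 'M[K]_(m, n) :=
  bounded_rank r `&` zero_pattern S.

(* Rows in A and columns in B, both listed in increasing order. *)
Definition minor (A : {set 'I_m}) (B : {set 'I_n}) (eqAB : #|A| = #|B|)
    (Y : 'M[K]_(m, n)) : K :=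
  \det (mxsub (fun i : 'I_#|A| => enum_val i)
              (fun j : 'I_#|A| => enum_val (cast_ord eqAB j)) Y).

End AffineGeometry.

Arguments bounded_rank K {m n} r.
Arguments zero_pattern K {m n} S.
Arguments structured_bounded_rank K {m n} r S.

(* Main.v *)
Require Import Defs.
From mathcomp Require Import all_boot all_order all_algebra.
From mathcomp Require Import classical_sets reals.
From mathcomp Require Import complex.
From mathcomp Require Import mpoly.

Import GRing.Theory Num.Theory.

Local Open Scope ring_scope.

(** The critical equations are tested only against tangent vectors that come
    from straight lines lying in the variety Z of matrices of rank at most r
    with the given zeros.

    If the line X + t V stays in Z, every polynomial p vanishing on Z restricts
    to the zero polynomial in t, so its differential kills V: V is tangent
    ([line_tangent]).  Take V = u^T w with u supported on A and w supported on
    B.  As A x B avoids S, adding t V does not disturb the zero pattern, so only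
    the rank matters.  It stays at most r when X has rank less than r, because
    V has rank at most one, and also when u^T lies in the column space of X,
    because then X + t V = X (1 + t z^T w) for some z ([bounded_rank_line]).

    If X has rank exactly r, a nonzero u supported on A exists in the column
    space of X because r + |A| > m; if the rank is smaller, any nonzero
    u supported on A will do ([exists_supported_column]).  Orthogonality of
    U - X to all such V, with w running over the unit vectors of B, says that
    the restriction of u to A is a nonzero vector in the left kernel of the
    A x B submatrix of U - X, so this submatrix has
    determinant zero. *)

Section LineRestriction.
Variables (K : comNzRingType) (d : nat) (x v : 'I_d -> K).

(** The univariate polynomial t |-> p (x + t v). *)
Definition restrict_line (p : {mpoly K[d]}) : {poly K} :=
  mmap polyC (fun k => (x k)%:P + v k *: 'X) p.

Lemma horner_restrict_line (p : {mpoly K[d]}) (t : K) :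
  (restrict_line p).[t] = p.@[fun k => x k + t * v k].
Proof.
rewrite /restrict_line /meval /mmap horner_sum; apply: eq_bigr => mon _.
rewrite hornerM hornerC /mmap1 horner_prod; congr (_ * _).
by apply: eq_bigr => k _; rewrite horner_exp !hornerE mulrC.
Qed.

Lemma restrict_line0 (p : {mpoly K[d]}) : (restrict_line p).[0] = p.@[x].
Proof.
by rewrite horner_restrict_line; apply: meval_eq => k; rewrite mul0r addr0.
Qed.

(** The chain rule along a line.  Both sides are derivations over evaluation at
    x, so it suffices to compare them on constants and on the variables. *)
Lemma deriv_restrict_line (p : {mpoly K[d]}) :
  (restrict_line p)^`().[0] = \sum_(k < d) (p^`M(k)).@[x] * v k.
Proof.
pose chain q := (restrict_line q)^`().[0] = \sum_(k < d) (q^`M(k)).@[x] * v k.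
have chainM q1 q2 : chain q1 -> chain q2 -> chain (q1 * q2).
  move=> chain1 chain2; rewrite /chain /restrict_line rmorphM /=.
  rewrite -!/(restrict_line _).
  rewrite derivM hornerD !hornerM chain1 chain2 !restrict_line0.
  rewrite mulr_suml mulr_sumr -big_split /=; apply: eq_bigr => k _.
  rewrite mderivM mevalD !mevalM mulrDl mulrA; congr (_ + _).
  by rewrite mulrAC.
have chain1 : chain 1.
  rewrite /chain /restrict_line rmorph1 derivC horner0 big1 // => k _.
  by rewrite -mpolyC1 mderivC meval0 mul0r.
elim/mpolyind: p => [|c mon q _ _ IHq].
  rewrite /restrict_line mmap0 deriv0 horner0 big1 // => k _.
  by rewrite mderiv0 meval0 mul0r.
have -> : restrict_line (c *: 'X_[mon] + q)
    = c *: restrict_line 'X_[mon] + restrict_line q.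
  by rewrite /restrict_line mmapD mmapZ mul_polyC.
rewrite derivD derivZ hornerD hornerZ IHq.
under [RHS]eq_bigr => k _ do
  rewrite mderivD mderivZ mevalD mevalZ mulrDl -mulrA.
rewrite big_split /= -mulr_sumr; congr (c * _ + _).
rewrite -/(chain _) mpolyXE_id; apply: (big_ind chain) => // i _.
elim: (mon i) => [|e IHe]; first by rewrite expr0.
rewrite exprS; apply: chainM => //.
rewrite /chain /restrict_line mmapX mmap1U derivD derivC derivZ derivX.
rewrite hornerD hornerC hornerZ hornerC mulr1 add0r (bigD1 i) //= big1 => [|k].
  rewrite mderivX mnm1E eqxx scale1r -[X in (X - _)%MM]add0m addmK.
  by rewrite mpolyX0 meval1 mul1r addr0.
by rewrite mderivX mnm1E eq_sym => /negPf ->; rewrite scale0r meval0 mul0r.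
Qed.

End LineRestriction.

Lemma vanishing_poly_eq0 (K : numDomainType) (p : {poly K}) :
  (forall t, p.[t] = 0) -> p = 0.
Proof.
move=> p0; apply/eqP/negPn/negP => pN0.
have := @max_poly_roots _ p [seq k%:R | k <- iota 0 (size p)] pN0.
rewrite size_map size_iota ltnn => H; apply: notF; apply: H.
  by apply/allP => t _; apply/eqP.
by rewrite map_inj_uniq ?iota_uniq //; apply: mulrIn; apply: oner_neq0.
Qed.

(** This is how tangent vectors of Z are produced without knowing the generators
    of its vanishing ideal. *)
Lemma line_tangent (K : numFieldType) (m n : nat)
    (Z : set 'M[K]_(m, n)) (X V : 'M[K]_(m, n)) :
  (forall t, Z (X + t *: V)) -> tangent_space Z X V.
Proof.
move=> lineZ p pZ0.
rewrite /differential /eval_mx.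
rewrite -deriv_restrict_line (@vanishing_poly_eq0 _ (restrict_line _ _ _ _ _)).
  by rewrite deriv0 horner0.
move=> t; rewrite horner_restrict_line -[RHS](pZ0 _ (lineZ t)).
by apply: meval_eq => k; rewrite linearD linearZ !mxE.
Qed.

(** Right multiplication by [rowsub f 1%:M] pushes a row vector forward along f;
    this is how vectors supported on the image of f are represented. *)
Lemma mul_rowsub1_eq0 (K : pzSemiRingType) (m k : nat) (f : 'I_k -> 'I_m)
    (y : 'rV[K]_k) (i : 'I_m) :
  (forall a, f a != i) -> (y *m rowsub f 1%:M) 0 i = 0.
Proof.
move=> fNi; rewrite !mxE big1 // => a _.
by rewrite !mxE (negPf (fNi a)) mulr0.
Qed.

Lemma mxsub_rowsub1 (K : pzSemiRingType) (m n k l : nat) (f : 'I_k -> 'I_m)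
    (g : 'I_l -> 'I_n) (M : 'M[K]_(m, n)) :
  mxsub f g M = rowsub f 1%:M *m M *m (rowsub g 1%:M)^T.
Proof.
rewrite trmx_mxsub trmx1 mul_rowsub_mx mul1mx mulmx_colsub mulmx1.
by rewrite -mxsub_comp.
Qed.

Lemma rowsub1_row_free (K : fieldType) (m k : nat) (f : 'I_k -> 'I_m) :
  injective f -> row_free (rowsub f (1%:M : 'M[K]_m)).
Proof.
move=> f_inj; apply/row_freeP; exists (rowsub f 1%:M)^T.
rewrite -[X in X *m _]mulmx1 -mxsub_rowsub1.
by apply/matrixP => a b; rewrite !mxE (inj_eq f_inj).
Qed.

(** In the first case the perturbation has rank at most one; in the second it is
    a right multiple of X. *)
Lemma bounded_rank_line (K : fieldType) (m n r : nat) (X : 'M[K]_(m, n))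
    (u : 'rV[K]_m) (w : 'rV[K]_n) (t : K) :
  (\rank X <= r)%N -> (\rank X < r)%N || (u <= X^T)%MS ->
  (\rank (X + t *: (u^T *m w))%R <= r)%N.
Proof.
move=> rX /orP[rXlt | /submxP[z uE]].
  apply: leq_trans rXlt; apply: leq_trans (mxrank_add _ _) _.
  rewrite -[X in (_ <= X)%N]addn1 leq_add2l.
  rewrite (leq_trans (mxrank_scale _ _)) //.
  by rewrite (leq_trans (mxrankM_maxr _ _)) // rank_leq_row.
rewrite uE trmx_mul trmxK -mulmxA scalemxAr.
rewrite -[X in (\rank (X + _)%R)]mulmx1 -mulmxDr.
exact: leq_trans (mxrankM_maxl _ _) rX.
Qed.

(** When the rank of X is at least r, the column space of X and the coordinate
    subspace carried by the image of f have dimensions adding up to more than m,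
    so they meet nontrivially. *)
Lemma exists_supported_column (K : fieldType) (m n r k : nat)
    (X : 'M[K]_(m, n)) (f : 'I_k -> 'I_m) :
  injective f -> (0 < k)%N -> (m < r + k)%N ->
  exists2 y : 'rV[K]_k, y != 0 &
    (\rank X < r)%N || (y *m rowsub f 1%:M <= X^T)%MS.
Proof.
move=> f_inj k_gt0 mrk; have [rXlt | rX] := ltnP (\rank X) r.
  exists (const_mx 1) => //; apply/eqP => /rowP/(_ (Ordinal k_gt0)).
  by rewrite !mxE => /eqP; rewrite oner_eq0.
set D := rowsub f 1%:M; pose C := (X^T :&: D)%MS.
have CN0 : C != 0.
  rewrite -mxrank_eq0 -lt0n -(ltn_add2l (\rank (X^T + D)%MS)).
  rewrite mxrank_sum_cap addn0.
  rewrite (eqP (rowsub1_row_free K _ _ _ f_inj)) mxrank_tr.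
  apply: leq_ltn_trans (rank_leq_col _) _.
  by apply: leq_trans mrk _; rewrite leq_add2r.
have /submxP[y yE] : (nz_row C <= D)%MS.
  exact: submx_trans (nz_row_sub _) (capmxSr _ _).
exists y.
  by apply: contraNneq CN0 => y0; rewrite -nz_row_eq0 yE y0 mul0mx.
by rewrite -yE; exact: submx_trans (nz_row_sub _) (capmxSl _ _).
Qed.

Theorem proposition4p18 (R : realType) (m n r : nat)
    (hmn : (m <= n)%N) (hr : (1 <= r <= m)%N)
    (S : {set 'I_m * 'I_n}) (U : 'M[R]_(m, n)) (X : 'M[R[i]]_(m, n))
    (hX : critical_point (map_mx (real_complex R) U)
            (structured_bounded_rank R[i] r S) X)
    (A : {set 'I_m}) (B : {set 'I_n}) (hAB : #|A| = #|B|)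
    (hA : (m - r + 1 <= #|A|)%N)
    (hS : S :&: finset.setX A B = finset.set0) :
  minor hAB (map_mx (real_complex R) U - X) = 0.
Proof.
have [[[rX zeroX] _] orthX] := hX.
rewrite /minor; set f := fun i => _; set g := fun j => _.
have f_inj : injective f by exact: enum_val_inj.
have [y yN0 yX] : exists2 y : 'rV[R[i]]_#|A|, y != 0 &
    (\rank X < r)%N || (y *m rowsub f 1%:M <= X^T)%MS.
  apply: exists_supported_column => //.
    by rewrite (leq_trans _ hA) // addn1.
  by have /andP[_ rm] := hr; rewrite -ltn_subLR // -addn1.
apply/eqP/det0P; exists y => //; apply/rowP => j.
set w : 'rV[R[i]]_n := row j (rowsub g 1%:M).
set M := map_mx _ U - X in orthX *.
(* Testing against u^T w, where w is the j-th unit vector of B, reads off the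
   j-th coordinate of y times the submatrix. *)
have trE : \tr (M *m ((y *m rowsub f 1%:M)^T *m w)^T)
    = (y *m mxsub f g M) 0 j.
  rewrite trmx_mul trmxK mulmxA mxtrace_mulC trace_mx11.
  by rewrite [mxsub f g M]mxsub_rowsub1 !mulmxA /w tr_row colE mulmxA -colE mxE.
rewrite -trE mxE; apply: orthX; apply: line_tangent => t; split.
  exact: bounded_rank_line.
move=> i k Sik; rewrite mxE zeroX // add0r mxE mxE big_ord1 [_^T _ _]mxE.
have [kB | kNB] := boolP (k \in B); last first.
  rewrite !mxE; case: eqP => [gk | _]; last by rewrite !mulr0.
  by rewrite -gk enum_valP in kNB.
rewrite mul_rowsub1_eq0 ?mul0r ?mulr0 // => a; apply: contraTneq Sik => <-.
apply/negP => Sfk; have : (f a, k) \in S :&: finset.setX A B.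
  by rewrite inE Sfk inE enum_valP.
by rewrite hS inE.
Qed.
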